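(* Let $R$ be a commutative ring with unit, and let $V=R\mathbb{N}$ be the free $R$-module with basis $(e_n)_{n\in\mathbb{N}}$. Let $U,D\colon V\to V$ be the $R$-linear maps with $U(e_n)=e_{n+1}$ for all $n\in\mathbb{N}$, $D(e_0)=0$ and $D(e_{n+1})=e_n$ for all $n\in\mathbb{N}$. Then for every $R$-linear endomorphism $\phi$ of $V$ there exists a unique sequence $(P_n(x))_{n\in\mathbb{N}}$ of polynomials in $R[x]$ such that $$\phi=\sum_{n\in\mathbb{N}}P_n(U)\circ D^n .$$ Moreover, the map $$\pi\colon R\langle x,y\rangle\rangle\to \mathrm{End}_R(V),\qquad \sum_{n\ge 0}P_n(x)y^n\mapsto \sum_{n\in\mathbb{N}}P_n(U)\circ D^n,$$ is an isomorphism of $R$-modules.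
   Context: $\mathrm{End}_R(V)$ denotes the $R$-module of all $R$-linear maps $V\to V$. For a polynomial $P(x)=\sum_{k=0}^m p_kx^k\in R[x]$ and $\phi\in\mathrm{End}_R(V)$, $P(\phi)=\sum_{k=0}^m p_k\phi^k$, with $\phi^0=\mathrm{id}_V$ and $\phi^{k+1}=\phi\circ\phi^k$. For any sequence $(\phi_n)_{n\in\mathbb{N}}$ in $\mathrm{End}_R(V)$, the sum $\sum_{n\in\mathbb{N}}\phi_n\circ D^n$ is the endomorphism $v\mapsto\sum_{n\in\mathbb{N}}\phi_n(D^n(v))$; for each $v$ only finitely many terms are non-zero, since $D^n(v)=0$ for all large $n$. (Equivalently, the sum is that of a summable family in the topology of simple, i.e. pointwise, convergence on $\mathrm{End}_R(V)$, with $V$ discrete.) $R\langle x,y\rangle\rangle$ denotes the $R$-submodule $\{\sum_{n\ge0}P_n(x)y^n : P_n(x)\in R[x]\text{ for all }n\}$ of the algebra $R\langle\langle x,y\rangle\rangle$ of formal power series in two non-commuting variables $x,y$; its elements correspond bijectively and $R$-linearly to sequences $(P_n)_{n}\in R[x]^{\mathbb{N}}$. *)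

(* Defs.v *)
From HB Require Import structures.
From mathcomp Require Import all_boot all_order all_algebra.
From mathcomp Require Import all_classical.

Set Implicit Arguments.
Unset Strict Implicit.
Unset Printing Implicit Defensive.

Import GRing.Theory.

Local Open Scope ring_scope.

(* [(f n)] is a summable family for pointwise convergence with [W] discrete,
   and [s] is its sum. *)
Definition is_pointwise_sum (T : Type) (W : nmodType)
    (f : nat -> T -> W) (s : T -> W) : Prop :=
  forall t, exists N : nat,
    (forall n, (N <= n)%N -> f n t = 0) /\ s t = \sum_(n < N) f n t.

Definition is_nat_basis (R : pzRingType) (V : lmodType R) (e : nat -> V) :=
  (forall v, exists (n : nat) (c : nat -> R), v = \sum_(i < n) c i *: e i) /\
  (forall (n : nat) (c : nat -> R), \sum_(i < n) c i *: e i = 0 ->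
     forall i, (i < n)%N -> c i = 0).

Section LinearMaps.
Variables (R : comPzRingType) (U V : lmodType R).
Implicit Types f g h : {linear U -> V}.

Lemma linear_eqP f g : f =1 g -> f = g.
Proof.
case: f g => [f [[fD0] [fZ]]] [g [[gD0] [gZ]]] /= /funext fg.
case: _ / fg in gD0 gZ *.
by rewrite (Prop_irrelevance fD0 gD0) (Prop_irrelevance fZ gZ).
Qed.

Definition linear_zero : {linear U -> V} := \0.
Definition linear_add f g : {linear U -> V} := f \+ g.
Definition linear_opp f : {linear U -> V} := \- f.

Definition linear_scale_fun (a : R) f (u : U) : V := a *: f u.

Fact linear_scale_is_linear a f : linear (linear_scale_fun a f).
Proof.
move=> b u v.
by rewrite /linear_scale_fun linearP scalerDr !scalerA mulrC.
Qed.

HB.instance Definition _ a f :=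
  GRing.isLinear.Build R U V *:%R (linear_scale_fun a f)
    (linear_scale_is_linear a f).

Definition linear_scale a f : {linear U -> V} := linear_scale_fun a f.

HB.instance Definition _ := gen_eqMixin {linear U -> V}.
HB.instance Definition _ := gen_choiceMixin {linear U -> V}.

Fact linear_addA : associative linear_add.
Proof. by move=> f g h; apply: linear_eqP => u /=; rewrite addrA. Qed.
Fact linear_addC : commutative linear_add.
Proof. by move=> f g; apply: linear_eqP => u /=; rewrite addrC. Qed.
Fact linear_add0 : left_id linear_zero linear_add.
Proof. by move=> f; apply: linear_eqP => u /=; rewrite add0r. Qed.
Fact linear_addN : left_inverse linear_zero linear_opp linear_add.
Proof. by move=> f; apply: linear_eqP => u /=; rewrite addNr. Qed.

HB.instance Definition _ := GRing.isZmodule.Build {linear U -> V}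
  linear_addA linear_addC linear_add0 linear_addN.

Fact linear_scaleA a b f :
  linear_scale a (linear_scale b f) = linear_scale (a * b) f.
Proof. by apply: linear_eqP => u /=; rewrite /linear_scale_fun /= scalerA. Qed.
Fact linear_scale1 : left_id 1 linear_scale.
Proof.
by move=> f; apply: linear_eqP => u; rewrite /= /linear_scale_fun scale1r.
Qed.
Fact linear_scaleDr : right_distributive linear_scale +%R.
Proof.
by move=> a f g; apply: linear_eqP => u; rewrite /= /linear_scale_fun scalerDr.
Qed.
Fact linear_scaleDl f : {morph linear_scale^~ f : a b / a + b}.
Proof.
by move=> a b; apply: linear_eqP => u; rewrite /= /linear_scale_fun scalerDl.
Qed.

HB.instance Definition _ := GRing.Zmodule_isLmodule.Build R {linear U -> V}
  linear_scaleA linear_scale1 linear_scaleDr linear_scaleDl.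

End LinearMaps.

Section PolyEndo.
Variables (R : comNzRingType) (V : lmodType R).

Fixpoint endo_exp (phi : {linear V -> V}) (k : nat) : {linear V -> V} :=
  if k is k'.+1 then phi \o endo_exp phi k' else idfun.

Definition poly_endo (P : {poly R}) (phi : {linear V -> V}) : {linear V -> V} :=
  \sum_(k < size P) P`_k *: endo_exp phi k.

End PolyEndo.

(* Formal power series in two non-commuting variables: a series is the family
   of its coefficients, indexed by the words in the letters x = false and
   y = true. *)
Definition ncps (R : Type) : Type := seq bool -> R.

Section NCPowerSeries.
Variable R : comNzRingType.
Implicit Types f g h : ncps R.

HB.instance Definition _ := GRing.Lmodule.copy (ncps R) (seq bool -> R^o).

Definition ncps_one : ncps R := fun w => (w == [::])%:R.

Definition ncps_mul f g : ncps R :=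
  fun w => \sum_(i < (size w).+1) f (take i w) * g (drop i w).

Lemma ncpsD f g w : (f + g) w = f w + g w. Proof. by []. Qed.
Lemma ncpsZ a f w : (a *: f) w = a * f w. Proof. by []. Qed.

Lemma ncps_mul_nil f g : ncps_mul f g [::] = f [::] * g [::].
Proof. by rewrite /ncps_mul big_ord1. Qed.

Lemma ncps_mul_cons f g b w :
  ncps_mul f g (b :: w) =
    f [::] * g (b :: w) + ncps_mul (fun u => f (b :: u)) g w.
Proof. by rewrite /ncps_mul /= big_ord_recl. Qed.

Fact ncps_mulDl : left_distributive ncps_mul +%R.
Proof.
move=> f g h; apply/funext => w.
rewrite ncpsD /ncps_mul -big_split /=.
by apply: eq_bigr => i _; rewrite mulrDl.
Qed.

Fact ncps_mulDr : right_distributive ncps_mul +%R.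
Proof.
move=> f g h; apply/funext => w.
rewrite ncpsD /ncps_mul -big_split /=.
by apply: eq_bigr => i _; rewrite mulrDr.
Qed.

Fact ncps_scaleAl a f g : a *: ncps_mul f g = ncps_mul (a *: f) g.
Proof.
apply/funext => w; rewrite ncpsZ /ncps_mul mulr_sumr.
by apply: eq_bigr => i _; rewrite ncpsZ mulrA.
Qed.

Fact ncps_scaleAr a f g : a *: ncps_mul f g = ncps_mul f (a *: g).
Proof.
apply/funext => w; rewrite ncpsZ /ncps_mul mulr_sumr.
by apply: eq_bigr => i _; rewrite ncpsZ mulrCA.
Qed.

Fact ncps_mul1 : left_id ncps_one ncps_mul.
Proof.
move=> f; apply/funext => -[|b w]; first by rewrite ncps_mul_nil mul1r.
rewrite ncps_mul_cons mul1r /ncps_mul big1 ?addr0 // => i _.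
by rewrite mul0r.
Qed.

Fact ncps_mulr1 : right_id ncps_one ncps_mul.
Proof.
move=> f; apply/funext => w.
rewrite /ncps_mul big_ord_recr /= take_size drop_size mulr1 big1 ?add0r //.
move=> i _; rewrite /ncps_one -size_eq0 size_drop subn_eq0.
by rewrite leqNgt ltn_ord mulr0.
Qed.

Fact ncps_mulA : associative ncps_mul.
Proof.
move=> f g h; apply/funext => w.
elim: w f g h => [|b w IHw] f g h; first by rewrite !ncps_mul_nil mulrA.
rewrite [LHS]ncps_mul_cons [RHS]ncps_mul_cons ncps_mul_nil ncps_mul_cons.
rewrite IHw mulrDr mulrA -addrA; congr (_ + _).
rewrite (_ : (fun u => ncps_mul f g (b :: u)) =
  f [::] *: ((fun u => g (b :: u)) : ncps R)
  + ncps_mul (fun u => f (b :: u)) g).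
  by rewrite ncps_mulDl -ncps_scaleAl.
by apply/funext => u; rewrite ncps_mul_cons.
Qed.

Fact ncps_one_neq0 : ncps_one != 0.
Proof.
apply/eqP => /(congr1 (fun f : ncps R => f [::])) /eqP.
by rewrite /ncps_one eqxx oner_eq0.
Qed.

HB.instance Definition _ := GRing.Zmodule_isNzRing.Build (ncps R)
  ncps_mulA ncps_mul1 ncps_mulr1 ncps_mulDl ncps_mulDr ncps_one_neq0.
HB.instance Definition _ :=
  GRing.Lmodule_isLalgebra.Build R (ncps R) ncps_scaleAl.
HB.instance Definition _ :=
  GRing.Lalgebra_isAlgebra.Build R (ncps R) ncps_scaleAr.

Lemma ncpsM f g w : (f * g) w = ncps_mul f g w. Proof. by []. Qed.

Definition ncps_x : ncps R := fun w => (w == [:: false])%:R.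
Definition ncps_y : ncps R := fun w => (w == [:: true])%:R.

Definition ncps_term (P : nat -> {poly R}) (n : nat) : ncps R :=
  horner_alg ncps_x (P n) * ncps_y ^+ n.

(* The series sum_n P_n(x) y^n: only the terms with n <= size w contribute to
   the coefficient of w, see ncps_xyP. *)
Definition ncps_xy (P : nat -> {poly R}) : ncps R :=
  fun w => \sum_(n < (size w).+1) ncps_term P n w.

Lemma ncps_mulyn_eq0 f n w : (size w < n)%N -> (f * ncps_y ^+ n) w = 0.
Proof.
elim: n f w => // n IHn f w ltwn.
rewrite exprSr mulrA ncpsM /ncps_mul big1 // => i _.
rewrite /ncps_y; have [dw|] := eqVneq; last by rewrite mulr0.
rewrite IHn ?mul0r // size_takel; last by rewrite -ltnS.
have := congr1 size dw; rewrite size_drop /= => sz.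
have : (i < size w)%N by rewrite -subn_gt0 sz.
by move/leq_trans; apply.
Qed.

Lemma ncps_xyP P : is_pointwise_sum (ncps_term P) (ncps_xy P).
Proof.
move=> w; exists (size w).+1; split=> // n ltwn.
exact: ncps_mulyn_eq0.
Qed.

Definition ncps_xy_pred : {pred ncps R} :=
  fun f => `[< exists P, f = ncps_xy P >].

Fact ncps_xy_submod_closed : submod_closed ncps_xy_pred.
Proof.
split.
  apply/asboolP; exists (fun=> 0); apply/funext => w.
  by rewrite /ncps_xy big1 // => n _; rewrite /ncps_term rmorph0 mul0r.
move=> a _ _ /asboolP[P ->] /asboolP[Q ->].
apply/asboolP; exists (fun n => a *: P n + Q n); apply/funext => w.
rewrite ncpsD ncpsZ /ncps_xy mulr_sumr -big_split /=.
apply: eq_bigr => n _.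
by rewrite /ncps_term linearP /= mulr_algl mulrDl -scalerAl ncpsD ncpsZ.
Qed.

HB.instance Definition _ :=
  GRing.isSubmodClosed.Build R (ncps R) ncps_xy_pred ncps_xy_submod_closed.

(* The submodule R<x,y>> of the algebra of power series. *)
Definition ncps_xy_type : Type := {f : ncps R | f \in ncps_xy_pred}.

HB.instance Definition _ := SubChoice.on ncps_xy_type.
HB.instance Definition _ := [SubChoice_isSubLmodule of ncps_xy_type by <:].

Fact ncps_xy_in P : ncps_xy P \in ncps_xy_pred.
Proof. by apply/asboolP; exists P. Qed.

Definition ncps_xy_sum (P : nat -> {poly R}) : ncps_xy_type :=
  exist _ (ncps_xy P) (ncps_xy_in P).

End NCPowerSeries.

(* Main.v *)
Require Import Defs.
From HB Require Import structures.
From mathcomp Require Import all_boot all_order all_algebra.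
From mathcomp Require Import all_classical.

Import GRing.Theory.
Local Open Scope ring_scope.

(** The map [p |-> p(U) e_0] is a linear isomorphism from [R[x]] onto [V], under
    which [U] is multiplication by [x].  Since [D^n e_m] is [e_(m-n)] or [0], the
    sum [phi] of [P_n(U) D^n] satisfies [phi e_0 = P_0(U) e_0] and
    [phi e_(m+1) = P_(m+1)(U) e_0 + U (phi e_m)].  Hence [P_(m+1)] is the
    polynomial corresponding to [phi e_(m+1) - U (phi e_m)]: this determines the
    sequence, and conversely defines one for any [phi]. *)

(** * Pointwise convergent sums of functions and of linear maps *)

Section PointwiseSums.
Set Implicit Arguments.
Unset Strict Implicit.

Lemma pointwise_sum_unique (T : Type) (W : nmodType) (f : nat -> T -> W)
    (s t : T -> W) :
  is_pointwise_sum f s -> is_pointwise_sum f t -> s =1 t.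
Proof.
move=> fs ft v; have [N [N0 ->]] := fs v; have [M [M0 ->]] := ft v.
pose F n := f n v.
have pad K L : (K <= L)%N -> (forall n, (K <= n)%N -> F n = 0) ->
    \sum_(n < K) F n = \sum_(n < L) F n.
  move=> leKL K0; rewrite (big_ord_widen _ F leKL) big_mkcond /=.
  by apply: eq_bigr => i _; case: ltnP => // /K0.
by have [le|/ltnW le] := leqP N M; [|symmetry]; apply: pad.
Qed.

(** The bound hidden in [is_pointwise_sum] is existential; this replaces it by any bound known at
    the single point [v]. *)
Lemma pointwise_sum_trunc {T : Type} {W : nmodType} {f : nat -> T -> W}
    {s : T -> W} {v : T} {N : nat} :
  is_pointwise_sum f s -> (forall n, (N <= n)%N -> f n v = 0) ->
  s v = \sum_(n < N) f n v.
Proof.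
move=> fs N0.
(* Vanishing beyond [N] is known at [v] only, so the family is frozen at [v] and viewed as a family
   of functions on [unit]. *)
apply: (@pointwise_sum_unique unit W (fun n _ => f n v) (fun=> s v)
  (fun=> \sum_(n < N) f n v) _ _ tt) => u; [exact: fs|by exists N].
Qed.

Lemma pointwise_sumP (T : Type) (R : pzRingType) (W : lmodType R) (a : R)
    (f g : nat -> T -> W) (s t : T -> W) :
  is_pointwise_sum f s -> is_pointwise_sum g t ->
  is_pointwise_sum (fun n v => a *: f n v + g n v) (fun v => a *: s v + t v).
Proof.
move=> fs gt v; have [N [N0 _]] := fs v; have [M [M0 _]] := gt v.
have f0 n : (maxn N M <= n)%N -> f n v = 0.
  by rewrite geq_max => /andP[/N0].
have g0 n : (maxn N M <= n)%N -> g n v = 0.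
  by rewrite geq_max => /andP[_ /M0].
exists (maxn N M); split=> [n le|]; first by rewrite f0 // g0 // scaler0 addr0.
rewrite (pointwise_sum_trunc fs f0) (pointwise_sum_trunc gt g0).
by rewrite scaler_sumr -big_split.
Qed.

(** The number of summands varies with [u], so linearity cannot be read off the formula for [s]. It
    comes from uniqueness: both sides of the linearity equation are sums of the same family. *)
Lemma linear_pointwise_sum_exists (R : pzRingType) (U V : lmodType R)
    (f : nat -> {linear U -> V}) :
  (forall u, exists N, forall n, (N <= n)%N -> f n u = 0) ->
  exists s : {linear U -> V}, is_pointwise_sum f s.
Proof.
move=> f0; pose N u := sval (cid (f0 u)).
pose s u := \sum_(n < N u) f n u.
have sP : is_pointwise_sum f s.
  by move=> u; exists (N u); split=> //; exact: (svalP (cid (f0 u))).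
have s_lin : linear s.
  move=> a u v.
  apply: (pointwise_sum_unique (f := fun n (_ : unit) => f n (a *: u + v))
    (s := fun=> s _) (t := fun=> a *: s u + s v) _ _ tt) => _; first exact: sP.
  have fs w : is_pointwise_sum (fun n (_ : unit) => f n w) (fun=> s w).
    by move=> ?; exact: sP.
  have [M [M0 ->]] := pointwise_sumP a (fs u) (fs v) tt; exists M.
  split=> [n /M0|]; first by rewrite linearP.
  by apply: eq_bigr => i _; rewrite linearP.
pose sL := GRing.isLinear.Build R U V *:%R s s_lin.
pose S : {linear U -> V} := HB.pack s sL.
by exists S.
Qed.

End PointwiseSums.

(** * Polynomials evaluated at an endomorphism *)

Section PolyEndoTheory.
Set Implicit Arguments.
Unset Strict Implicit.
Variables (R : comNzRingType) (V : lmodType R) (U : {linear V -> V}).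

(** Coefficients past the size are zero, so polynomials of different sizes can be expanded over one
    common range. *)
Lemma poly_endoE {p : {poly R}} {N : nat} (v : V) : (size p <= N)%N ->
  poly_endo p U v = \sum_(k < N) p`_k *: endo_exp U k v.
Proof.
move=> leN; rewrite /poly_endo.
rewrite (big_morph (fun f : {linear V -> V} => f v) (id1 := 0) (op1 := +%R)) //.
rewrite (big_ord_widen _ (fun k => p`_k *: endo_exp U k v) leN) big_mkcond /=.
apply: eq_bigr => i _; case: ltnP => // le.
by rewrite nth_default // scale0r.
Qed.

Lemma poly_endoP (a : R) (p q : {poly R}) (v : V) :
  poly_endo (a *: p + q) U v = a *: poly_endo p U v + poly_endo q U v.
Proof.
pose N := maxn (size (a *: p + q)) (maxn (size p) (size q)).
rewrite !(@poly_endoE _ N) ?leq_max ?leqnn ?orbT //.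
rewrite scaler_sumr -big_split /=; apply: eq_bigr => i _.
by rewrite coefD coefZ scalerDl scalerA.
Qed.

Lemma poly_endo_comm (p : {poly R}) (v : V) :
  poly_endo p U (U v) = U (poly_endo p U v).
Proof.
rewrite !(poly_endoE _ (leqnn _)) linear_sum; apply: eq_bigr => i _.
rewrite linearZ; congr (_ *: _).
by elim: (i : nat) => //= k ->.
Qed.

End PolyEndoTheory.

(** * Coefficients of the series in R<x,y>> and the sequences they determine *)

Section Words.
Set Implicit Arguments.
Unset Strict Implicit.
Variable R : comNzRingType.
Implicit Types (f : ncps R) (w : seq bool) (p : {poly R}).

(** Convertible to [ncps_x] at [false] and to [ncps_y] at [true], so that one computation of powers
    serves both variables. *)
Definition ncps_letter (c : bool) : ncps R := fun w => (w == [:: c])%:R.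

Lemma ncps_letter_exp c n w : (ncps_letter c ^+ n) w = (w == nseq n c)%:R.
Proof.
elim: n w => [|n IHn] w; first by rewrite expr0.
rewrite exprS ncpsM; case: w => [|b w].
  by rewrite ncps_mul_nil mul0r.
(* A single letter has a non-zero coefficient only on words of length one, so only the cut after [b]
   survives. *)
rewrite ncps_mul_cons mul0r add0r /ncps_mul big_ord_recl big1 => [|i _] /=.
  rewrite take0 drop0 IHn addr0 /ncps_letter !eqseq_cons eqxx andbT.
  by case: eqP => _ /=; rewrite ?mul1r ?mul0r.
by case: w i => [[]|b' w i] //=; rewrite /ncps_letter eqseq_cons /= andbF mul0r.
Qed.

Lemma horner_alg_ncps_x p w :
  horner_alg (ncps_x R) p w = \sum_(i < size p) p`_i * (w == nseq i false)%:R.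
Proof.
rewrite -{1}(coefK p) poly_def linear_sum.
rewrite (big_morph (fun f : ncps R => f w) (id1 := 0) (op1 := +%R)) //.
apply: eq_bigr => i _.
rewrite linearZ /= rmorphXn /= horner_algX mulr_algl ncpsZ.
by congr (_ * _); apply: (ncps_letter_exp false).
Qed.

(** Counting each of the two letters recovers the exponents. *)
Lemma cat_nseq_inj j k m n :
  nseq j false ++ nseq m true = nseq k false ++ nseq n true -> j = k /\ m = n.
Proof.
move=> eq_w; split.
  have := congr1 (count_mem false) eq_w.
  by rewrite !count_cat !count_nseq /= !mul1n !mul0n !addn0.
have := congr1 (count_mem true) eq_w.
by rewrite !count_cat !count_nseq /= !mul1n !mul0n.
Qed.

Lemma ncps_term_coef (P : nat -> {poly R}) n k m :
  ncps_term P n (nseq k false ++ nseq m true) = (n == m)%:R * (P n)`_k.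
Proof.
set w := _ ++ _.
have szw : size w = (k + m)%N by rewrite size_cat !size_nseq.
have yn v : (ncps_y R ^+ n) v = (v == nseq n true)%:R.
  exact: (ncps_letter_exp true).
rewrite /ncps_term ncpsM /ncps_mul.
have ltk : (k < (size w).+1)%N by rewrite szw ltnS leq_addr.
(* The product is a sum over the cuts of the word x^k y^m. The cut between the two blocks carries
   the whole value. *)
rewrite (bigD1 (Ordinal ltk)) //= big1 => [|i ne_ik].
  rewrite addr0 yn drop_size_cat ?size_nseq // take_size_cat ?size_nseq //.
  rewrite horner_alg_ncps_x mulrC.
  have -> : (nseq m true == nseq n true) = (n == m).
    apply/eqP/eqP => [/(congr1 size)|->//]; by rewrite !size_nseq.
  congr (_ * _).
  have [lek|ltkp] := leqP (size (P n)) k.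
    rewrite nth_default // big1 // => i _.
    case: eqP => [/(congr1 size)|_]; last by rewrite mulr0.
    rewrite !size_nseq => eq_ki; have := ltn_ord i.
    by rewrite -eq_ki ltnNge lek.
  rewrite (bigD1 (Ordinal ltkp)) //= eqxx mulr1 big1 ?addr0 // => i ne_i.
  case: eqP => [/(congr1 size)|_]; last by rewrite mulr0.
  rewrite !size_nseq => eq_ki; case/eqP: ne_i; exact: val_inj.
(* A cut at [i] different from [k] contributes only if its suffix is y^n and its prefix is some x^j.
   Then x^j y^n = x^k y^m, so [j = k]; but the prefix has length [i], a contradiction. *)
rewrite yn; case: eqP => [dw|_]; last by rewrite mulr0.
rewrite mulr1 horner_alg_ncps_x big1 // => j _.
case: eqP => [tw|_]; last by rewrite mulr0.
have eq_w : nseq j false ++ nseq n true = nseq k false ++ nseq m true.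
  by rewrite -tw -dw cat_take_drop.
have [eq_jk _] := cat_nseq_inj eq_w.
case/eqP: ne_ik; apply: val_inj => /=.
by rewrite -eq_jk -(size_nseq j false) -tw size_takel // -ltnS.
Qed.

(** The words x^k y^n suffice to read every coefficient of every P_n off the series, which gives
    injectivity of [ncps_xy]. *)
Lemma ncps_xy_coef (P : nat -> {poly R}) k n :
  ncps_xy P (nseq k false ++ nseq n true) = (P n)`_k.
Proof.
have ltn : (n < (size (nseq k false ++ nseq n true)).+1)%N.
  by rewrite size_cat !size_nseq ltnS leq_addl.
rewrite /ncps_xy (bigD1 (Ordinal ltn)) //= ncps_term_coef eqxx mul1r.
rewrite big1 ?addr0 // => i ne_i; rewrite ncps_term_coef.
by case: eqP => [eq_i|_]; [case/eqP: ne_i; apply: val_inj|rewrite mul0r].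
Qed.

Lemma ncps_xy_inj : injective (@ncps_xy R).
Proof.
move=> P Q eqPQ; apply/funext => n; apply/polyP => k.
by rewrite -!ncps_xy_coef eqPQ.
Qed.

Lemma ncps_xyD_scale (a : R) (P Q : nat -> {poly R}) :
  ncps_xy (fun n => a *: P n + Q n) = a *: ncps_xy P + ncps_xy Q.
Proof.
apply/funext => w; rewrite ncpsD ncpsZ /ncps_xy mulr_sumr -big_split /=.
apply: eq_bigr => n _.
by rewrite /ncps_term linearP /= mulr_algl mulrDl -scalerAl ncpsD ncpsZ.
Qed.

(** Membership in R<x,y>> only asserts that a sequence exists, so one is chosen; [ncps_xy_inj] makes
    the choice unambiguous, hence inverse to [ncps_xy_sum]. *)
Definition ncps_xy_seq (f : ncps_xy_type R) : nat -> {poly R} :=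
  sval (cid (asboolW (valP f))).

Lemma ncps_xy_seqK : cancel ncps_xy_seq (@ncps_xy_sum R).
Proof.
by move=> f; apply: val_inj => /=; rewrite -(svalP (cid (asboolW (valP f)))).
Qed.

Lemma ncps_xy_sumK : cancel (@ncps_xy_sum R) ncps_xy_seq.
Proof.
move=> P; apply: ncps_xy_inj.
by have /(congr1 val) := ncps_xy_seqK (ncps_xy_sum P).
Qed.

Lemma ncps_xy_seqP (a : R) (f g : ncps_xy_type R) :
  ncps_xy_seq (a *: f + g) = fun n => a *: ncps_xy_seq f n + ncps_xy_seq g n.
Proof.
apply: (can_inj ncps_xy_sumK); rewrite ncps_xy_seqK; apply: val_inj.
rewrite /= ncps_xyD_scale.
have /(congr1 val) /= -> := ncps_xy_seqK f.
by have /(congr1 val) /= -> := ncps_xy_seqK g.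
Qed.

End Words.

(** * Expansion of endomorphisms in terms of the two shifts *)

Section ShiftOperators.
Set Implicit Arguments.
Unset Strict Implicit.
Variables (R : comNzRingType) (V : lmodType R) (e : nat -> V).
Hypothesis he : is_nat_basis e.
Variables U D : {linear V -> V}.
Hypotheses (hU : forall n, U (e n) = e n.+1) (hD0 : D (e 0%N) = 0).
Hypothesis hD : forall n, D (e n.+1) = e n.

Lemma up_exp n : endo_exp U n (e 0%N) = e n.
Proof. by elim: n => //= n ->. Qed.

Lemma down_exp n m :
  endo_exp D n (e m) = if (n <= m)%N then e (m - n)%N else 0.
Proof.
elim: n => [|n IHn] /=; first by rewrite subn0.
rewrite IHn; case: (ltngtP n m) => [lt_nm|//|->]; last by rewrite subnn hD0.
- by rewrite -(subnSK lt_nm) hD.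
- by rewrite linear0.
Qed.

Lemma down_nilpotent v :
  exists N, forall n, (N <= n)%N -> endo_exp D n v = 0.
Proof.
have [N [c ->]] := he.1 v.
exists N => n le; rewrite linear_sum big1 // => i _.
by rewrite linearZ down_exp leqNgt (leq_trans (ltn_ord i) le) /= scaler0.
Qed.

Lemma poly_up_surj v : exists p : {poly R}, v = poly_endo p U (e 0%N).
Proof.
have [n [c ->]] := he.1 v; exists (\poly_(i < n) c i).
rewrite (poly_endoE _ _ (size_poly _ _)); apply: eq_bigr => i _.
by rewrite coef_poly ltn_ord up_exp.
Qed.

(** The coefficients of the difference [d] are those of a vanishing combination of the basis
    vectors, so independence kills them. *)
Lemma poly_up_inj (p q : {poly R}) :
  poly_endo p U (e 0%N) = poly_endo q U (e 0%N) -> p = q.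
Proof.
move=> eq_pq; pose d := (-1) *: q + p.
have : poly_endo d U (e 0%N) = 0.
  by rewrite poly_endoP eq_pq scaleN1r addNr.
rewrite (poly_endoE _ _ (leqnn _)).
under eq_bigr do rewrite up_exp.
move=> /(he.2 _ (fun i => d`_i)) d0.
apply/eqP; rewrite -subr_eq0 addrC -scaleN1r.
apply/eqP/polyP => i; rewrite coef0.
by have [le|lt] := leqP (size d) i; [rewrite nth_default|apply: d0].
Qed.

Definition normal_sum (P : nat -> {poly R}) :=
  is_pointwise_sum (fun n => poly_endo (P n) U \o endo_exp D n).

Lemma normal_sum_exists P : exists s : {linear V -> V}, normal_sum P s.
Proof.
apply: (@linear_pointwise_sum_exists _ _ _
  (fun n => poly_endo (P n) U \o endo_exp D n)) => v.
by have [N N0] := down_nilpotent v; exists N => n /N0 /= ->; rewrite linear0.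
Qed.

Lemma normal_sum_basis P (s : V -> V) m : normal_sum P s ->
  s (e m) = \sum_(n < m.+1) poly_endo (P n) U (e (m - n)%N).
Proof.
move=> /(@pointwise_sum_trunc _ _ _ _ (e m) m.+1) ->.
  by apply: eq_bigr => i _ /=; rewrite down_exp -ltnS ltn_ord.
by move=> n lt_mn /=; rewrite down_exp leqNgt lt_mn /= linear0.
Qed.

Lemma normal_sum0 P (s : V -> V) : normal_sum P s ->
  s (e 0%N) = poly_endo (P 0%N) U (e 0%N).
Proof. by move=> /normal_sum_basis ->; rewrite big_ord1. Qed.

(** The term [n = m.+1] sees D^n e_(m+1) = e_0. In each earlier term e_(m+1-n) is U applied to
    e_(m-n), and U commutes with P_n(U), so it can be pulled out of the sum. *)
Lemma normal_sumS P (s : V -> V) m : normal_sum P s ->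
  s (e m.+1) = poly_endo (P m.+1) U (e 0%N) + U (s (e m)).
Proof.
move=> sP; rewrite !(normal_sum_basis _ sP) big_ord_recr /= subnn addrC.
rewrite linear_sum; congr (_ + _); apply: eq_bigr => i _.
by rewrite (subSn (ltnSE (ltn_ord i))) -hU poly_endo_comm.
Qed.

Lemma normal_sum_inj P Q (s : V -> V) :
  normal_sum P s -> normal_sum Q s -> P = Q.
Proof.
move=> sP sQ; apply/funext => -[|m]; apply: poly_up_inj.
  by rewrite -(normal_sum0 sP) -(normal_sum0 sQ).
apply: (addIr (U (s (e m)))).
by rewrite -(normal_sumS _ sP) -(normal_sumS _ sQ).
Qed.

Lemma linear_basis_ext (f g : {linear V -> V}) :
  (forall n, f (e n) = g (e n)) -> f =1 g.
Proof.
move=> fg v; have [n [c ->]] := he.1 v.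
by rewrite !linear_sum; apply: eq_bigr => i _; rewrite !linearZ fg.
Qed.

Lemma normal_sum_surj (phi : {linear V -> V}) : exists P, normal_sum P phi.
Proof.
have [P0 hP0] := poly_up_surj (phi (e 0%N)).
(* The target vector involves only [phi], not the polynomials found before, so all P_n are chosen
   independently, without recursion. *)
pose Q m := cid (poly_up_surj (phi (e m.+1) - U (phi (e m)))).
pose P n := if n is m.+1 then sval (Q m) else P0.
have [s sP] := normal_sum_exists P; exists P.
suff -> : phi = s by [].
(* The sum [s] of the chosen family obeys the recursion that [P] was built to solve, so [s] and
   [phi] agree on each [e m] by induction. *)
apply: linear_eqP; apply: linear_basis_ext; elim=> [|m IHm].
  by rewrite (normal_sum0 sP).
by rewrite (normal_sumS _ sP) -(svalP (Q m)) IHm subrK.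
Qed.

End ShiftOperators.

Theorem mainTheorem1 (R : comNzRingType) (V : lmodType R) (e : nat -> V)
    (he : is_nat_basis e)
    (U D : {linear V -> V})
    (hU : forall n : nat, U (e n) = e n.+1)
    (hD0 : D (e 0%N) = 0)
    (hD : forall n : nat, D (e n.+1) = e n) :
  (forall phi : {linear V -> V},
     exists! P : nat -> {poly R},
       is_pointwise_sum (fun n => poly_endo (P n) U \o endo_exp D n) phi) /\
  (exists pi : {linear ncps_xy_type R -> {linear V -> V}},
     (forall P : nat -> {poly R},
        is_pointwise_sum (fun n => poly_endo (P n) U \o endo_exp D n)
          (pi (ncps_xy_sum P))) /\
     bijective pi).
Proof.
have sum_ex := normal_sum_exists he U hD0 hD.
have sum_surj := normal_sum_surj he hU hD0 hD.
have sum_inj P Q s := @normal_sum_inj _ _ _ he _ _ hU hD0 hD P Q s.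
split=> [phi|].
  by have [P phiP] := sum_surj phi; exists P; split=> // Q; apply: sum_inj.
pose p f := sval (cid (sum_ex (ncps_xy_seq f))).
have pP f : normal_sum U D (ncps_xy_seq f) (p f).
  exact: svalP (cid (sum_ex _)).
have p_lin : linear p.
  move=> a f g; apply: linear_eqP.
  (* Since [p] is defined by choice, linearity again goes through uniqueness: [a *: p f + p g] is
     shown to be a sum for the sequence of [a *: f + g], which is the termwise combination. *)
  apply: (pointwise_sum_unique (pP _)); rewrite ncps_xy_seqP.
  move=> v.
  have [N [N0 Nv]] := pointwise_sumP a (pP f) (pP g) v.
  exists N; split=> [n /N0|]; first by rewrite /= poly_endoP.
  by rewrite [LHS]Nv; apply: eq_bigr => i _ /=; rewrite poly_endoP.
pose pL := GRing.isLinear.Build _ _ _ *:%R p p_lin.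
pose pi : {linear ncps_xy_type R -> {linear V -> V}} := HB.pack p pL.
exists pi; split=> [P|].
  by have := pP (ncps_xy_sum P); rewrite ncps_xy_sumK.
(* The inverse sends [phi] to the series of a sequence expanding it. One composite is the identity
   by uniqueness of the sequence, the other by uniqueness of the sum. *)
exists (fun phi => ncps_xy_sum (sval (cid (sum_surj phi)))) => [f|phi].
  rewrite -[RHS]ncps_xy_seqK; congr ncps_xy_sum.
  exact: sum_inj _ _ _ (svalP (cid (sum_surj _))) (pP f).
apply: linear_eqP; apply: (pointwise_sum_unique (pP _)).
rewrite ncps_xy_sumK; exact: svalP (cid (sum_surj _)).
Qed.
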